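(* Let $(t_n)_{n\ge 0}$ be the sequence defined by $t_0=0$ and $t_n=n^{n-1}/n!$ for $n\ge 1$, and let $(u_n)_{n\ge 0}$ be the sequence defined by $u_n=n^n$ (with $u_0=0^0=1$). Then neither $(t_n)_{n\ge 0}$ nor $(u_n)_{n\ge 0}$ is holonomic.
   Context: A sequence $(f_n)_{n\ge0}$ of complex numbers is called holonomic (or $P$-recursive) if there exist an integer $d\ge 0$ and polynomials $p_0,\dots,p_d\in\mathbb{C}[X]$, not all zero, such that $p_0(n)f_{n+d}+p_1(n)f_{n+d-1}+\cdots+p_d(n)f_n=0$ for all integers $n\ge 0$. *)

(* Defs.v *)
From mathcomp Require Import all_boot all_order all_algebra.
From mathcomp Require Import reals.
From mathcomp Require Import complex.

Set Implicit Arguments.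
Unset Strict Implicit.
Unset Printing Implicit Defensive.

Import GRing.Theory.
Local Open Scope ring_scope.
Local Open Scope complex_scope.

(* R is any complete ordered archimedean field, so R[i] is the field of
   complex numbers. The sum is p_0(n) f_{n+d} + ... + p_d(n) f_n. *)
Definition holonomic (R : realType) (f : nat -> R[i]) : Prop :=
  exists (d : nat) (p : 'I_d.+1 -> {poly R[i]}),
    (exists k, p k != 0) /\
    forall n : nat, \sum_(k < d.+1) (p k).[n%:R] * f (n + (d - k))%N = 0.

Definition tree_seq (R : realType) (n : nat) : R[i] :=
  if n == 0%N then 0 else n%:R ^+ n.-1 / n`!%:R.

(* x ^+ 0 is 1 for every x, so the value at n = 0 is 0^0 = 1. *)
Definition self_power_seq (R : realType) (n : nat) : R[i] := n%:R ^+ n.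

(* Main.v *)
Require Import Defs.
From mathcomp Require Import all_boot all_order all_algebra all_field.
From mathcomp Require Import reals.
From mathcomp Require Import complex.

Set Implicit Arguments.
Unset Strict Implicit.
Unset Printing Implicit Defensive.

Import GRing.Theory Num.Theory.
Local Open Scope ring_scope.

(** Up to nonzero polynomial factors and a factor depending on n only, a
    recurrence for either sequence reads sum_j q_j(n) (n + j + 1)^n = 0. The
    coefficients of the q_j solve a linear system with natural coefficients, so
    it suffices that this system has only the zero solution modulo some prime p:
    a maximal minor that is nonzero modulo p is nonzero over the complex numbers.
    Modulo a large p, Fermat's little theorem lets n mod p = a and the exponent
    n mod (p - 1) = b vary independently. For fixed a, a Vandermonde argument in
    b gives q_j(a) = 0, and there are more such a than the degree of q_j. *)

Lemma row_full_of_ker0 (F : fieldType) (m n : nat) (A : 'M[F]_(m, n)) :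
  (forall v : 'cV_n, A *m v = 0 -> v = 0) -> row_full A.
Proof.
move=> kerA; suff: row_free A^T by rewrite /row_free /row_full mxrank_tr.
rewrite -kermx_eq0; apply/eqP/row_matrixP => i; rewrite row0.
apply: trmx_inj; rewrite trmx0; apply: kerA.
by apply: trmx_inj; rewrite trmx_mul trmxK -row_mul mulmx_ker row0 trmx0.
Qed.

Lemma row_full_mulmx_eq0 (F : fieldType) (m n k : nat) (A : 'M[F]_(m, n))
    (B : 'M_(n, k)) : row_full A -> A *m B = 0 -> B = 0.
Proof.
by case/row_fullP => C CA AB0; rewrite -[B]mul1mx -CA -mulmxA AB0 mulmx0.
Qed.

(** A maximal minor chosen over [F] is the image of an integer determinant; being nonzero in [F],
    that integer is nonzero, hence also nonzero in [K], of characteristic 0. *)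
Lemma row_full_intr_transfer (F : fieldType) (K : numFieldType) (m n : nat)
    (A : 'M[int]_(m, n)) :
  row_full (map_mx intr A : 'M[F]_(m, n)) ->
  row_full (map_mx intr A : 'M[K]_(m, n)).
Proof.
move=> fullF; have := fullrowsub_unit fullF.
set f := fullrankfun fullF; rewrite -map_mxsub unitmxE det_map_mx unitfE => detF.
have detA : \det (rowsub f A) != 0.
  by apply: contraNneq detF => ->; rewrite rmorph0.
have uK : rowsub f (map_mx intr A : 'M[K]_(m, n)) \in unitmx.
  by rewrite -map_mxsub unitmxE det_map_mx unitfE intr_eq0.
apply: row_full_of_ker0 => v Av0.
apply: (@row_full_mulmx_eq0 _ _ _ _ (rowsub f (map_mx intr A))).
  by rewrite row_full_unit.
by rewrite mul_rowsub_mx Av0; apply/matrixP => i j; rewrite !mxE.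
Qed.

Lemma nat_system_ker0_transfer (F : fieldType) (K : numFieldType) (S T : finType)
    (a : S -> T -> nat) :
  (forall c : T -> F, (forall s, \sum_t (a s t)%:R * c t = 0) ->
     forall t, c t = 0) ->
  forall c : T -> K, (forall s, \sum_t (a s t)%:R * c t = 0) ->
     forall t, c t = 0.
Proof.
move=> kerF c c0 t.
pose A : 'M[int]_(#|S|, #|T|) :=
  \matrix_(i, j) (a (enum_val i) (enum_val j))%:R.
have mulE (L : pzRingType) (v : 'cV[L]_#|T|) i :
    (map_mx intr A *m v) i 0 =
    \sum_t (a (enum_val i) t)%:R * v (enum_rank t) 0.
  rewrite mxE (reindex (@enum_rank T)) /=; last first.
    by apply: onW_bij; apply: enum_rank_bij.
  by apply: eq_bigr => u _; rewrite !mxE enum_rankK rmorph_nat.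
have fullF : row_full (map_mx intr A : 'M[F]__).
  apply: row_full_of_ker0 => v Av0; apply/colP => j; rewrite mxE.
  rewrite -[j]enum_valK.
  apply: (kerF (fun t => v (enum_rank t) 0)) => s.
  by rewrite -[s]enum_rankK -mulE Av0 mxE.
pose v : 'cV[K]_#|T| := \col_j c (enum_val j).
have /matrixP/(_ (enum_rank t) 0) : v = 0.
  apply: (row_full_mulmx_eq0 (row_full_intr_transfer K fullF)).
  apply/colP => i; rewrite mulE mxE -[RHS](c0 (enum_val i)).
  by apply: eq_bigr => u _; rewrite mxE enum_rankK.
by rewrite !mxE enum_rankK.
Qed.

Lemma power_sums_eq0 (F : fieldType) (m : nat) (x c : 'I_m -> F) :
  injective x -> (forall b : 'I_m, \sum_j c j * x j ^+ b = 0) ->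
  forall j, c j = 0.
Proof.
move=> injx sum0 j.
(* Up to scaling, [h] is the Lagrange polynomial of node [x j]. Its degree is below [m], so the
   given power sums combine to [c j * h.[x j] = 0]. *)
pose h := \prod_(i in predC1 j) ('X - (x i)%:P).
have szh : (size h <= m)%N.
  rewrite /h -big_enum size_prod_XsubC -cardE cardC1 card_ord.
  by rewrite prednK // (leq_ltn_trans _ (ltn_ord j)).
have hE i : i != j -> h.[x i] = 0.
  by move=> ij; rewrite /h (bigD1 i) //= hornerM hornerXsubC subrr mul0r.
have: \sum_i c i * h.[x i] = 0.
  under eq_bigr => i _ do rewrite (horner_coef_wide _ szh) mulr_sumr.
  rewrite exchange_big big1 //= => b _.
  under eq_bigr => i _ do rewrite mulrCA.
  by rewrite -mulr_sumr sum0 mulr0.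
rewrite (bigD1 j) //= big1 ?addr0; last by move=> i /hE ->; rewrite mulr0.
move/eqP; rewrite mulf_eq0 => /orP[/eqP//|].
rewrite horner_prod prodf_seq_eq0 => /hasP[i _ /andP[ij]].
by rewrite hornerXsubC subr_eq0 => /eqP/injx ji; rewrite inE ji eqxx in ij.
Qed.

Lemma Fp_natr_eq0 (p n : nat) : prime p -> ((n%:R : 'F_p) == 0) = (p %| n)%N.
Proof. by move=> p_pr; rewrite -(dvdn_pcharf (pchar_Fp p_pr)). Qed.

(* By Fermat, x ^ n = x ^ b mod p for n = p b + (p - 1) c with x prime to p,
   whereas n = - c mod p: base and exponent can be prescribed independently. *)
Lemma Fp_expr_fermat (p b c : nat) (x : 'F_p) : prime p -> x != 0 ->
  x ^+ (p * b + p.-1 * c) = x ^+ b.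
Proof.
move=> p_pr x0; have xp : x ^+ p = x by rewrite -{2}(expf_card x) card_Fp.
have xp1 : x ^+ p.-1 = 1.
  by apply: (mulfI x0); rewrite -exprS prednK ?prime_gt0 // mulr1.
by rewrite exprD !exprM xp xp1 expr1n mulr1.
Qed.

Lemma Fp_natr_fermat (p b c : nat) : prime p ->
  (p * b + p.-1 * c)%:R = - c%:R :> 'F_p.
Proof.
move=> p_pr; apply/eqP; rewrite -subr_eq0 opprK -natrD Fp_natr_eq0 //.
rewrite -addnA -mulSnr prednK ?prime_gt0 //.
by rewrite dvdn_add // dvdn_mulr.
Qed.

Lemma Fp_natr_inj (p m n : nat) : prime p -> (m < p)%N -> (n < p)%N ->
  m%:R = n%:R :> 'F_p -> m = n.
Proof.
move=> p_pr; wlog le_mn : m n / (m <= n)%N => [wlog_mn|] mp np.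
  case/orP: (leq_total m n) => [/wlog_mn h /(h mp np)//|/wlog_mn h].
  by move/esym/(h np mp)/esym.
move/esym/eqP; rewrite -subr_eq0 -natrB // Fp_natr_eq0 // => pd.
apply/eqP; rewrite eqn_leq le_mn /= -subn_eq0.
case: posnP => [|n0] //.
by have := dvdn_leq n0 pd; rewrite leqNgt (leq_ltn_trans (leq_subr _ _) np).
Qed.

(* The coefficient of the unknown t.2-th coefficient of q_(t.1) in the equation
   at n = p b + (p - 1) c, where s = (b, c). *)
Definition shifted_power_entry (p m D : nat) (s : 'I_m * 'I_p.+1)
    (t : 'I_m * 'I_D) : nat :=
  let n := p * s.1 + p.-1 * s.2 in n ^ t.2 * (n + t.1.+1) ^ n.

Lemma Fp_shifted_powers_indep (p m D : nat) (c : 'I_m * 'I_D -> 'F_p) :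
  prime p -> (m + D < p)%N ->
  (forall s : 'I_m * 'I_p.+1, \sum_t (shifted_power_entry s t)%:R * c t = 0) ->
  forall t, c t = 0.
Proof.
move=> p_pr mDp sum0 [j i].
pose q j := \poly_(i < D) (if insub i is Some i' then c (j, i') else 0).
have qE (k : 'I_m) x : (q k).[x] = \sum_(i < D) c (k, i) * x ^+ i.
  by rewrite horner_poly; apply: eq_bigr => i' _; rewrite valK.
(* The bounds on [a] give [0 < a - k.+1 < p], so each base [k.+1 - a] is nonzero mod [p], as Fermat
   requires. *)
have q_roots (a : nat) : (m < a <= p)%N -> (q j).[- a%:R] = 0.
  case/andP=> ma ap.
  apply: (@power_sums_eq0 _ _ (fun k : 'I_m => - a%:R + k.+1%:R)
             (fun k => (q k).[- a%:R])) => [k l /addrI/Fp_natr_inj kl|b].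
    have lt_p (k' : 'I_m) : (k'.+1 < p)%N.
      by apply: leq_ltn_trans (ltn_ord k') (leq_ltn_trans (leq_addr D m) mDp).
    by apply/val_inj; case: (kl p_pr (lt_p _) (lt_p _)).
  (* At [n = p * b + p.-1 * a], [n] becomes [- a] and the exponent becomes [b]. *)
  rewrite -[RHS](sum0 (b, inord a)) /shifted_power_entry /= inordK //.
  under eq_bigr => k _ do rewrite qE mulr_suml.
  rewrite pair_bigA; apply: eq_bigr => -[k l] _ /=.
  rewrite natrM !natrX (natrD _ _ k.+1) Fp_natr_fermat // Fp_expr_fermat //.
    by rewrite [RHS]mulrC mulrA.
  have ka : (k.+1 < a)%N by apply: leq_ltn_trans (ltn_ord k) ma.
  suff: (a - k.+1)%:R != 0 :> 'F_p.
    rewrite natrB 1?ltnW //; apply: contra_neq => ak.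
    by rewrite -opprB addrC ak oppr0.
  rewrite Fp_natr_eq0 //.
  apply/negP => /dvdn_leq; rewrite subn_gt0 ka => /(_ isT).
  by rewrite leqNgt (leq_trans _ ap) // ltn_subrL (leq_trans _ ka).
have q0 : q j = 0.
  (* The values [m + 1, ..., m + D] are all below [p], so they give [D] distinct roots, while
     [size (q j) <= D]. *)
  apply: (@roots_geq_poly_eq0 _ _ [seq - a%:R | a <- iota m.+1 D]).
  - apply/allP => _ /mapP[a + ->]; rewrite mem_iota addSn ltnS => /andP[ma aD].
    by apply/rootP/q_roots; rewrite ma (leq_trans aD (ltnW mDp)).
  - rewrite map_inj_in_uniq ?iota_uniq // => a b.
    rewrite !mem_iota !addSn !ltnS => /andP[_ aD] /andP[_ bD] /oppr_inj.
    by apply: Fp_natr_inj; rewrite // (leq_ltn_trans _ mDp).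
  - by rewrite size_map size_iota size_poly.
have := congr1 (fun r : {poly _} => r`_i) q0.
by rewrite coef_poly ltn_ord valK coef0.
Qed.

Lemma shifted_powers_indep (K : numFieldType) (m : nat) (q : 'I_m -> {poly K}) :
  (forall n : nat, \sum_j (q j).[n%:R] * (n + j.+1)%:R ^+ n = 0) ->
  forall j, q j = 0.
Proof.
move=> sum0 j.
pose D := \max_j size (q j).
have szq k : (size (q k) <= D)%N by apply: leq_bigmax.
have [p mDp p_pr] := prime_above (m + D).
pose c (t : 'I_m * 'I_D) := (q t.1)`_t.2.
have c0 := @nat_system_ker0_transfer _ K _ _ (@shifted_power_entry p m D)
  (fun b => @Fp_shifted_powers_indep p m D b p_pr mDp) c.
apply/polyP => i; rewrite coef0.
have [iD|Di] := ltnP i D; last by rewrite nth_default // (leq_trans _ Di).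
apply: (c0 _ (j, Ordinal iD)) => s; rewrite -[RHS](sum0 (p * s.1 + p.-1 * s.2)%N).
under [RHS]eq_bigr => k _ do rewrite (horner_coef_wide _ (szq k)) mulr_suml.
rewrite pair_bigA; apply: eq_bigr => -[k l] _.
rewrite /shifted_power_entry /= natrM !natrX /c /=.
by rewrite mulrC mulrA.
Qed.

(** Common reduction for both sequences: [w] clears denominators, and [g j] is the polynomial factor
    left beside the power with exponent [n]. *)
Lemma recurrence_of_powers_eq0 (K : numFieldType) (f w : nat -> K) (d : nat)
    (g : nat -> {poly K}) (p : 'I_d.+1 -> {poly K}) :
  (forall j, g j != 0) ->
  (forall n j, (j <= d)%N ->
     w n * f (n + j.+1)%N = (g j).[n%:R] * (n + j.+1)%:R ^+ n) ->
  (forall n : nat, \sum_(k < d.+1) (p k).[n%:R] * f (n + (d - k))%N = 0) ->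
  forall k, p k = 0.
Proof.
move=> g0 wE rec k.
pose q (j : 'I_d.+1) := (p (rev_ord j) \Po ('X + 1%:P)) * g j.
have q0 : forall j, q j = 0.
  (* Using the recurrence at [n.+1] keeps every index positive, away from the special value at 0;
     hence the composition with ['X + 1] in [q]. *)
  apply: shifted_powers_indep => n; have := congr1 ( *%R (w n)) (rec n.+1).
  rewrite mulr0 (reindex_inj rev_ord_inj) mulr_sumr => rec0.
  rewrite -[RHS]rec0; apply: eq_bigr => l _ /=.
  have -> : (n.+1 + (d - (d.+1 - l.+1)) = n + l.+1)%N.
    by rewrite addSnnS subSS subKn // -ltnS.
  rewrite mulrCA wE; last by rewrite -ltnS.
  by rewrite /q hornerM horner_comp !hornerE natr1.
have /eqP := q0 (rev_ord k); rewrite /q rev_ordK mulf_eq0 (negPf (g0 _)) orbF.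
by rewrite comp_poly2_eq0 ?size_XaddC // => /eqP.
Qed.

Lemma XaddC_neq0 (K : idomainType) (c : K) : 'X + c%:P != 0.
Proof. by rewrite -size_poly_gt0 size_XaddC. Qed.

Lemma self_power_recurrence_eq0 (K : numFieldType) (d : nat)
    (p : 'I_d.+1 -> {poly K}) :
  (forall n : nat, \sum_(k < d.+1)
     (p k).[n%:R] * (n + (d - k))%:R ^+ (n + (d - k)) = 0) ->
  forall k, p k = 0.
Proof.
(* With [x = n + j + 1], the term [x ^ x] splits as [x ^ (j + 1) * x ^ n]. *)
apply: (@recurrence_of_powers_eq0 K (fun n => n%:R ^+ n) (fun=> 1) d
  (fun j => ('X + j.+1%:R%:P) ^+ j.+1)) => [j|n j _].
  by rewrite expf_neq0 ?XaddC_neq0.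
by rewrite mul1r horner_exp !hornerE -natrD -exprD addnC.
Qed.

Lemma fact_add_prod (n j d : nat) : (j <= d)%N ->
  ((n + d)`! = (n + j)`! * \prod_(j <= i < d) (n + i.+1))%N.
Proof.
elim: d => [|d IHd]; first by rewrite leqn0 => /eqP ->; rewrite big_geq ?muln1.
rewrite leq_eqVlt => /predU1P[->|]; first by rewrite big_geq ?muln1.
by move=> jd; rewrite big_nat_recr //= mulnA -IHd // addnS factS mulnC.
Qed.

Lemma tree_recurrence_eq0 (K : numFieldType) (d : nat)
    (p : 'I_d.+1 -> {poly K}) :
  (forall n : nat, \sum_(k < d.+1) (p k).[n%:R] *
     (if (n + (d - k) == 0)%N then 0
      else (n + (d - k))%:R ^+ (n + (d - k)).-1 / (n + (d - k))`!%:R) = 0) ->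
  forall k, p k = 0.
Proof.
(* With [x = n + j + 1], the numerator is [x ^ (n + j) = x ^ j * x ^ n], and [(n + d + 1)! / x!] is
   the product of the [n + i + 1] for [j < i <= d]. *)
apply: (@recurrence_of_powers_eq0 K
  (fun n => if n == 0%N then 0 else n%:R ^+ n.-1 / n`!%:R)
  (fun n => (n + d.+1)`!%:R) d
  (fun j => ('X + j.+1%:R%:P) ^+ j *
     \prod_(j.+1 <= i < d.+1) ('X + i.+1%:R%:P))) => [j|n j jd].
  rewrite mulf_neq0 ?expf_neq0 ?XaddC_neq0 //.
  by rewrite prodf_seq_neq0; apply/allP => i _; rewrite XaddC_neq0.
rewrite (@fact_add_prod n j.+1) // addnS /= -addnS.
rewrite hornerM horner_exp horner_prod hornerD hornerX hornerC natrM natr_prod.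
rewrite -natrD.
under [X in _ = _ * X * _]eq_bigr => i _ do rewrite hornerD hornerX hornerC -natrD.
have f0 : (n + j.+1)`!%:R != 0 :> K by rewrite pnatr_eq0 -lt0n fact_gt0.
by rewrite mulrC mulrA divfK // exprD [RHS]mulrC mulrA.
Qed.

Theorem mainTheorem5 (R : realType) :
  ~ holonomic (@tree_seq R) /\ ~ holonomic (@self_power_seq R).
Proof.
split=> -[d [p [[k /eqP pk0] rec]]]; apply: pk0.
- exact: (tree_recurrence_eq0 rec).
- exact: (self_power_recurrence_eq0 rec).
Qed.
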